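(* Let $p$ be a prime and let $(X,S)$ be an association scheme such that $T:= \mathbf{O}_\theta(S) = \mathbf{O}^\theta(S) \cong C_p \times C_p$. Then the incidence structure $(\mathcal{P}, \mathcal{L})$ of $(X,S)$ is a partial linear space such that any point belongs to at most $p+1$ lines, and $\mathrm{Aut}(X/T,S/\!/T)$ is a subgroup of $\mathrm{Aut}(\mathcal{P}, \mathcal{L})$ (where $X/T$ is identified with $\mathcal{P}$ via $X_i\leftrightarrow i$).
   Context: An association scheme $(X,S)$ consists of a non-empty finite set $X$ and a partition $S$ of $X\times X$ such that: (i) $1_X:=\{(x,x)\mid x\in X\}\in S$; (ii) for each $s\in S$, $s^*:=\{(x,y)\mid (y,x)\in s\}\in S$; (iii) for all $s,t,u\in S$ the number $c_{st}^u:=|xs\cap yt^*|$ is constant whenever $(x,y)\in u$, where $xs:=\{y\in X\mid (x,y)\in s\}$. The valency of $s$ is $n_s:=c_{ss^*}^{1_X}$. For non-empty $P,Q\subseteq S$, the complex product $PQ$ is the set of all $s\in S$ with $c_{pq}^s\neq 0$ for some $p\in P$, $q\in Q$; singletons $\{s\}$ are written $s$. A non-empty $T\subseteq S$ is closed if $TT\subseteq T$, thin if moreover all its elements have valency 1 (then $T$ is a group under the relational product), and strongly normal if it is closed and $s^*Ts\subseteq T$ for all $s\in S$. The thin radical is $\mathbf{O}_\theta(S):=\{s\in S\mid n_s=1\}$; the thin residue $\mathbf{O}^\theta(S)$ is the intersection of all strongly normal closed subsets of $S$ (it is itself strongly normal). For $T$ closed, $xT:=\bigcup_{t\in T}xt$,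 $X/T:=\{xT\mid x\in X\}$ is the set of cosets, $s^T:=\{(xT,yT)\mid y\in xTsT\}$ and $S/\!/T:=\{s^T\mid s\in S\}$; $(X/T,S/\!/T)$ is the quotient scheme. For a scheme $(Y,R)$, $\mathrm{Aut}(Y,R)$ is the group of permutations $\phi$ of $Y$ such that $(x^\phi,y^\phi)\in r$ whenever $(x,y)\in r$, for every $r\in R$ (every relation is fixed). The incidence structure. Let $T:=\mathbf{O}^\theta(S)\cong C_p\times C_p$ and let $X_1,\dots,X_m$ be the cosets of $T$ in $X$. For $s\in S$ put $L(s):=\{t\in T\mid ts=s\}$; it satisfies $L(s)=L(s')$ for $s'\in TsT$. For $i,j\in\{1,\dots,m\}$ put $L_{ij}:=L(s)$ for any $s\in S$ with $s\cap(X_i\times X_j)\neq\varnothing$ (this is independent of the choice of $s$). For a subgroup $M$ with $\{1_X\}<M<T$ (strict inclusions) put $L_i(M):=\{i\}\cup\{j\mid L_{ij}=M\}$. Define $\mathcal{P}:=\{1,\dots,m\}$ (points) and $\mathcal{L}:=\{L_i(M)\mid \{1_X\}<M<T,\ |L_i(M)|\neq 1,\ 1\le i\le m\}$ (lines). A partial linear space is a pair $(\mathcal{P},\mathcal{L})$ of a set $\mathcal{P}$ of points and a family $\mathcal{L}$ of subsets of $\mathcal{P}$ (lines) such that every pair of distinct points is contained in at most one line and every line contains at least two points ($\mathcal{L}$ may be empty). $\mathrm{Aut}(\mathcal{P},\mathcal{L})$ is the group of permutations $\tau$ of $\mathcal{P}$ with $\mathcal{L}^\tau=\mathcal{L}$.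 *)

(* Defs.v *)
From HB Require Import structures.
From mathcomp Require Import all_boot all_order all_fingroup all_algebra.
Set Implicit Arguments.
Unset Strict Implicit.
Unset Printing Implicit Defensive.

Section Relations.
Variable X : finType.
Implicit Types (x y : X) (r s t u : {set X * X}).

Definition rel_id : {set X * X} := [set (x, x) | x : X].

Definition rel_inv s : {set X * X} := [set w | (w.2, w.1) \in s].

Definition rel_comp r s : {set X * X} :=
  [set w | [exists y, ((w.1, y) \in r) && ((y, w.2) \in s)]].

(* xs *)
Definition out x s : {set X} := [set y | (x, y) \in s].

(* xP, the union of the sets xs for s in P *)
Definition outs x (P : {set {set X * X}}) : {set X} := \bigcup_(s in P) out x s.

Definition association_scheme (S : {set {set X * X}}) : Prop :=
  [/\ 0 < #|X|,
      partition S [set: X * X],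
      rel_id \in S,
      {in S, forall s, rel_inv s \in S}
    & {in S & &, forall s t u, exists c : nat, forall x y, (x, y) \in u ->
        #|out x s :&: out y (rel_inv t)| = c}].

(* The structure constant c_{st}^u, read off an arbitrary pair of u; this is
   independent of the pair when s, t, u belong to an association scheme. *)
Definition struct_const s t u : nat :=
  if [pick w in u] is Some w then #|out w.1 s :&: out w.2 (rel_inv t)| else 0.

Definition valency s : nat := struct_const s (rel_inv s) rel_id.

(* T is isomorphic to C_p x C_p for the relational product; for p > 1 the
   additive group of 'Z_p is cyclic of order p. *)
Definition isog_CpxCp (p : nat) (T : {set {set X * X}}) : Prop :=
  exists f : 'Z_p * 'Z_p -> {set X * X},
    [/\ injective f, f @: [set: 'Z_p * 'Z_p] = T
      & {morph f : a b / (a + b)%R >-> rel_comp a b}].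

(* M is a subgroup of T, a thin closed set viewed as a group for the
   relational product (with unit rel_id and inverse rel_inv). *)
Definition rel_subgroup (T M : {set {set X * X}}) : bool :=
  [&& M \subset T, rel_id \in M,
      [forall s in M, forall t in M, rel_comp s t \in M]
    & [forall s in M, rel_inv s \in M]].

Section Scheme.
Variable S : {set {set X * X}}.
Implicit Types P Q T M : {set {set X * X}}.

Definition cprod P Q : {set {set X * X}} :=
  [set s in S | [exists p in P, exists q in Q, struct_const p q s != 0]].

Definition closed_subset T : bool :=
  [&& T != set0, T \subset S & cprod T T \subset T].

Definition strongly_normal T : bool :=
  closed_subset T &&
  [forall s in S, cprod (cprod [set rel_inv s] T) [set s] \subset T].

Definition thin_radical : {set {set X * X}} := [set s in S | valency s == 1].

Definition thin_residue : {set {set X * X}} :=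
  \bigcap_(T : {set {set X * X}} | strongly_normal T) T.

Definition cosets T : {set {set X}} := [set outs x T | x : X].

Definition quotient_rel T s : {set {set X} * {set X}} :=
  [set (outs w.1 T, outs w.2 T) |
    w : X * X & w.2 \in outs w.1 (cprod (cprod T [set s]) T)].

Definition quotient_rels T : {set {set {set X} * {set X}}} :=
  [set quotient_rel T s | s in S].

Definition left_stab T s : {set {set X * X}} :=
  [set t in T | cprod [set t] [set s] == [set s]].

(* L_{ij} for the cosets C = X_i and D = X_j; in the situation of interest
   left_stab T s is the same for all s in S meeting C x D. *)
Definition coset_stab T (C D : {set X}) : {set {set X * X}} :=
  if [pick s in S | s :&: setX C D != set0] is Some s
  then left_stab T s else set0.

(* The points of the incidence structure are the cosets of T themselves
   instead of their indices 1, ..., m. *)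
Definition points T : {set {set X}} := cosets T.

Definition line T (C : {set X}) M : {set {set X}} :=
  C |: [set D in points T | coset_stab T C D == M].

Definition lines T : {set {set {set X}}} :=
  [set line T v.1 v.2 | v : {set X} * {set {set X * X}} &
    [&& v.1 \in points T, rel_subgroup T v.2, [set rel_id] \proper v.2,
        v.2 \proper T & #|line T v.1 v.2| != 1]].

End Scheme.
End Relations.

(* Schemes and incidence structures on a subset Y of a finite type U: the
   permutations of Y are the permutations of U supported on Y. *)
Section Automorphisms.
Variable U : finType.
Implicit Types (Y : {set U}) (f g : {perm U}).

Definition scheme_aut Y (R : {set {set U * U}}) : {set {perm U}} :=
  [set f | perm_on Y f &&
    [forall r in R, forall w in r, (f w.1, f w.2) \in r]].

Fact scheme_aut_group_set Y R : group_set (scheme_aut Y R).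
Proof.
apply/group_setP; split=> [|f g].
  rewrite inE perm_on1; apply/forall_inP=> r _; apply/forall_inP=> -[x y].
  by rewrite !perm1.
rewrite !inE => /andP[fY /forall_inP fR] /andP[gY /forall_inP gR].
rewrite perm_onM //=; apply/forall_inP=> r rR; apply/forall_inP=> w wr.
rewrite !permM; have /forall_inP/(_ _ wr) fw := fR r rR.
by have /forall_inP/(_ _ fw) := gR r rR.
Qed.

Canonical scheme_aut_group Y R := Group (scheme_aut_group_set Y R).

Definition incidence_aut Y (L : {set {set U}}) : {set {perm U}} :=
  [set f | perm_on Y f && ([set [set f x | x in l] | l : {set U} in L] == L)].

Fact incidence_aut_group_set Y L : group_set (incidence_aut Y L).
Proof.
apply/group_setP; split=> [|f g].
  rewrite inE perm_on1; apply/eqP; rewrite -[RHS]imset_id.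
  apply: eq_imset => l; rewrite -[RHS]imset_id.
  by apply: eq_imset => x; rewrite perm1.
rewrite !inE => /andP[fY /eqP fL] /andP[gY /eqP gL].
rewrite perm_onM //=; apply/eqP; rewrite -[RHS]gL -{2}fL -imset_comp.
apply: eq_imset => l /=; rewrite -imset_comp.
by apply: eq_imset => x /=; rewrite permM.
Qed.

Canonical incidence_aut_group Y L := Group (incidence_aut_group_set Y L).

Definition partial_linear_space Y (L : {set {set U}}) : Prop :=
  [/\ {in L, forall l : {set U}, l \subset Y},
      {in Y &, forall x y, x != y ->
        #|[set l : {set U} in L | (x \in l) && (y \in l)]| <= 1}
    & {in L, forall l : {set U}, 2 <= #|l|}].

End Automorphisms.

(* Main.v *)
(* Write L(s) = s s^* for a relation s outside T, a nontrivial subgroup of T of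
   order n_s.  If L(s) = L(u), where s joins X_i to X_j and u joins X_i to X_k,
   then every v in s^* u satisfies
   L(v) = v v^* <= s^* u u^* s = s^* L(s) s = s^* s = L(s^* ).
   When L(s) has order p, so has L(s^* ), and therefore L_jk = L_ji as soon as j
   and k are distinct.  Hence L_i(L_ij) = L_j(L_ji): a line can be based at any
   of its points, so it is determined by two of them, and the lines through j
   are given by the p + 1 subgroups of order p.  An automorphism of the quotient
   scheme preserves every double coset TsT, hence all the L_ij. *)
Require Import Defs.
From mathcomp Require Import all_boot all_order all_fingroup all_algebra.
Set Implicit Arguments.
Unset Strict Implicit.
Unset Printing Implicit Defensive.

(** * Association schemes in terms of points and structure constants *)

Section Scheme.
Variables (X : finType) (S : {set {set X * X}}).
Hypothesis schemeS : association_scheme S.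
Implicit Types (x y z u v : X) (s t : {set X * X}).

(** Every relation of the scheme is [rel_of x y] for some pair, so identities between relations
    become statements about points and paths. *)
Definition rel_of x y := pblock S (x, y).

Lemma rel_of_mem x y : rel_of x y \in S.
Proof.
have [_ partS _ _ _] := schemeS; apply: pblock_mem.
by rewrite (cover_partition partS) inE.
Qed.

Lemma mem_rel_of x y : (x, y) \in rel_of x y.
Proof.
have [_ partS _ _ _] := schemeS.
by rewrite mem_pblock (cover_partition partS) inE.
Qed.

Lemma rel_of_def s x y : s \in S -> (x, y) \in s -> rel_of x y = s.
Proof. by have [_ /and3P[_ tiS _] _ _ _] := schemeS; apply: def_pblock. Qed.

Lemma rel_ofE s x y : s \in S -> (rel_of x y == s) = ((x, y) \in s).
Proof.
move=> sS; apply/eqP/idP => [<-|]; [exact: mem_rel_of | exact: rel_of_def].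
Qed.

Lemma ex_rel_of s : s \in S -> exists x, exists y, rel_of x y = s.
Proof.
have [_ /and3P[_ _ S0] _ _ _] := schemeS => sS.
have /set0Pn[[x y] xys] : s != set0 by apply: contraNneq S0 => <-.
by exists x, y; apply: rel_of_def.
Qed.

Lemma rel_of_id x : rel_of x x = rel_id X.
Proof.
by have [_ _ idS _ _] := schemeS; apply: rel_of_def => //; apply: imset_f.
Qed.

Lemma rel_of_eq_id x y : rel_of x y = rel_id X -> x = y.
Proof. by move=> xy; have := mem_rel_of x y; rewrite xy => /imsetP[z _ [-> ->]]. Qed.

Lemma rel_of_inv x y : rel_of y x = rel_inv (rel_of x y).
Proof.
have [_ _ _ invS _] := schemeS; apply: rel_of_def; first by rewrite invS ?rel_of_mem.
by rewrite inE mem_rel_of.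
Qed.

Lemma rel_of_sym x y u v : rel_of x y = rel_of u v -> rel_of y x = rel_of v u.
Proof. by rewrite (rel_of_inv x) (rel_of_inv u) => ->. Qed.

Lemma struct_const_rel_of s t x y : s \in S -> t \in S ->
  struct_const s t (rel_of x y) = #|out x s :&: out y (rel_inv t)|.
Proof.
have [_ _ _ _ regS] := schemeS => sS tS; rewrite /struct_const.
have [c Hc] := regS _ _ _ sS tS (rel_of_mem x y).
case: pickP => [[x' y'] xy'|/(_ (x, y))]; last by rewrite mem_rel_of.
by rewrite !Hc ?mem_rel_of.
Qed.

Lemma struct_const_neq0 s t x y : s \in S -> t \in S ->
  reflect (exists z, rel_of x z = s /\ rel_of z y = t)
          (struct_const s t (rel_of x y) != 0).
Proof.
move=> sS tS; rewrite struct_const_rel_of // cards_eq0.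
apply: (iffP (set0Pn _)) => -[z].
  by rewrite !inE /= => /andP[xz zy]; exists z; split; apply: rel_of_def.
by move=> [<- <-]; exists z; rewrite !inE /= !mem_rel_of.
Qed.

(** Whether a structure constant vanishes depends only on the relation, so a triangle on (x, y) can
    be copied onto any pair in the same relation. *)
Lemma rel_of_transport z x y u v : rel_of x y = rel_of u v ->
  exists w, rel_of u w = rel_of x z /\ rel_of w v = rel_of z y.
Proof.
move=> xyuv; apply/struct_const_neq0; rewrite ?rel_of_mem // -xyuv.
by apply/struct_const_neq0; rewrite ?rel_of_mem //; exists z.
Qed.

Lemma cprodP (P Q : {set {set X * X}}) x y : P \subset S -> Q \subset S ->
  reflect (exists z, rel_of x z \in P /\ rel_of z y \in Q)
          (rel_of x y \in Defs.cprod S P Q).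
Proof.
move=> /subsetP PS /subsetP QS; rewrite inE rel_of_mem /=.
apply: (iffP exists_inP) => [[a aP /exists_inP[b bQ]]|[z [xzP zyQ]]].
  have aS := PS _ aP; have bS := QS _ bQ.
  by case/(struct_const_neq0 _ _ aS bS) => z [xz zy]; exists z; rewrite xz zy.
exists (rel_of x z) => //; apply/exists_inP; exists (rel_of z y) => //.
by apply/struct_const_neq0; rewrite ?rel_of_mem //; exists z.
Qed.

Lemma cprod_sub (P Q : {set {set X * X}}) : Defs.cprod S P Q \subset S.
Proof. by apply/subsetP => s; rewrite inE => /andP[]. Qed.

(** * Valencies, the thin radical and the thin residue *)

Lemma card_out s x : s \in S -> #|out x s| = valency s.
Proof.
have [_ _ _ invS _] := schemeS => sS; rewrite /valency -(rel_of_id x).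
rewrite struct_const_rel_of ?invS //; congr #|pred_of_set _|.
by apply/setP=> y; rewrite !inE /= andbb.
Qed.

Lemma card_rel s : s \in S -> #|s| = #|X| * valency s.
Proof.
move=> sS; rewrite -sum1_card (eq_bigl (fun w => true && ((w.1, w.2) \in s))).
  rewrite -(pair_big_dep xpredT (fun x y => (x, y) \in s) (fun _ _ => 1)) /=.
  rewrite -sum_nat_const; apply: eq_bigr => x _.
  by rewrite -(card_out x sS) -sum1_card; apply: eq_bigl => y; rewrite inE.
by case.
Qed.

(** Transposing pairs is a bijection from s to s^*, and |s| = |X| n_s with X non-empty. *)
Lemma valency_inv s : s \in S -> valency (rel_inv s) = valency s.
Proof.
have [X0 _ _ invS _] := schemeS => sS; apply/eqP.
rewrite -(eqn_pmul2l X0) -!card_rel ?invS //; apply/eqP.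
have swapK : cancel (fun w : X * X => (w.2, w.1)) (fun w => (w.2, w.1)) by case.
rewrite -(card_imset _ (can_inj swapK)); congr #|pred_of_set _|.
apply/setP=> w; apply/imsetP/idP => [[v vs ->]|ws]; first by rewrite inE in vs.
by exists (w.2, w.1); rewrite ?inE //=; case: w ws.
Qed.

Lemma rel_id_thin : rel_id X \in thin_radical S.
Proof.
have [/card_gt0P[x _] _ idS _ _] := schemeS; rewrite inE idS /= -(card_out x) //.
rewrite -(rel_of_id x) -(cards1 x); apply/eqP; congr #|pred_of_set _|.
apply/setP=> y; rewrite !inE -rel_ofE ?rel_of_mem //.
apply/eqP/eqP => [|->] //; rewrite (rel_of_id x) => xy.
exact/esym/rel_of_eq_id.
Qed.

Lemma rel_inv_thin t : t \in thin_radical S -> rel_inv t \in thin_radical S.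
Proof.
have [_ _ _ invS _] := schemeS.
by rewrite !inE => /andP[tS /eqP t1]; rewrite invS // valency_inv // t1.
Qed.

Lemma thin_radical_ex x t : t \in thin_radical S -> exists y, rel_of x y = t.
Proof.
rewrite inE => /andP[tS]; rewrite -(card_out x tS) => /cards1P[y xt].
by exists y; apply: rel_of_def => //; have := set11 y; rewrite -xt inE.
Qed.

Lemma thin_radical_fun x y y' :
  rel_of x y \in thin_radical S -> rel_of x y' = rel_of x y -> y' = y.
Proof.
rewrite inE => /andP[xyS]; rewrite -(card_out x xyS) => /cards1P[z xt] xy'.
have := mem_rel_of x y; have := mem_rel_of x y'.
have E w : ((x, w) \in rel_of x y) = (w == z) by rewrite -in_set1 -xt inE.
by rewrite xy' !E => /eqP-> /eqP->.
Qed.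

(** The copy of the triangle (x, x', y) over (u, v) has its middle vertex in the relation r(x, x')
    with u, and thinness forces that vertex to be u'. *)
Lemma thin_radical_move x x' y u u' v : rel_of x x' \in thin_radical S ->
  rel_of u u' = rel_of x x' -> rel_of x y = rel_of u v ->
  rel_of x' y = rel_of u' v.
Proof.
move=> xx'T uu' /(rel_of_transport x')[w [uw wv]].
by rewrite -wv -uu' in uw *; rewrite (thin_radical_fun _ uw) // uu'.
Qed.

(** With s = r(x, y) = r(x, y'), the path y, x, x, y' puts r(y, y') in s^* T s for every strongly
    normal T, since each such T contains the identity. *)
Lemma thin_residue_rel_of x y y' : rel_id X \in thin_residue S ->
  rel_of x y = rel_of x y' -> rel_of y y' \in thin_residue S.
Proof.
have [_ _ _ invS _] := schemeS => /bigcapP idR xyy'; apply/bigcapP => T snT.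
have := idR T snT; case/andP: snT => /and3P[_ TS _] /forall_inP nT idT.
have /subsetP/(_ (rel_of y y')) := nT _ (rel_of_mem x y); apply.
apply/cprodP; rewrite ?cprod_sub ?sub1set ?rel_of_mem //.
exists x; rewrite in_set1 xyy' eqxx; split=> //.
apply/cprodP; rewrite ?sub1set ?invS ?rel_of_mem //.
by exists x; rewrite rel_of_id idT -xyy' rel_of_inv set11.
Qed.

End Scheme.

(** * The stabilisers L(s) when T is both the thin radical and the thin residue *)

Section ThinResidue.
Variables (X : finType) (S T : {set {set X * X}}).
Hypothesis schemeS : association_scheme S.
Hypothesis T_radical : T = thin_radical S.
Hypothesis T_residue : T = thin_residue S.
Hypothesis T_comp : {in T &, forall a b, rel_comp a b \in T}.
Hypothesis T_comm : {in T &, forall a b, rel_comp a b = rel_comp b a}.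
Implicit Types (x y z u v : X) (a b s t : {set X * X}) (M : {set {set X * X}}).
Local Notation r := (rel_of S).

Lemma T_sub : T \subset S.
Proof. by rewrite T_radical; apply/subsetP=> t; rewrite inE => /andP[]. Qed.

Lemma T_id : rel_id X \in T.
Proof. by rewrite T_radical; apply: rel_id_thin. Qed.

Lemma T_sym x y : r x y \in T -> r y x \in T.
Proof.
by rewrite T_radical => xyT; rewrite (rel_of_inv schemeS x) rel_inv_thin.
Qed.

Lemma T_rel_comp x y z : r x y \in T -> r y z \in T ->
  rel_comp (r x y) (r y z) = r x z.
Proof.
move=> xyT yzT; apply/esym/(rel_of_def schemeS).
  exact: (subsetP T_sub) (T_comp xyT yzT).
by rewrite inE; apply/existsP; exists y; rewrite !mem_rel_of.
Qed.

Lemma T_trans x y z : r x y \in T -> r y z \in T -> r x z \in T.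
Proof. by move=> xyT yzT; rewrite -(T_rel_comp xyT yzT) T_comp. Qed.

Lemma T_ex x t : t \in T -> exists y, r x y = t.
Proof. by rewrite T_radical; exact: (thin_radical_ex schemeS). Qed.

Lemma T_fun x y y' : r x y \in T -> r x y' = r x y -> y' = y.
Proof. by rewrite T_radical; exact: (thin_radical_fun schemeS). Qed.

Lemma T_movel x x' y u u' v : r x x' \in T -> r u u' = r x x' ->
  r x y = r u v -> r x' y = r u' v.
Proof. by rewrite T_radical; exact: (thin_radical_move schemeS). Qed.

Lemma T_mover x y y' u v v' : r y y' \in T -> r v v' = r y y' ->
  r x y = r u v -> r x y' = r u v'.
Proof.
move=> yy'T vv' xyuv; apply: rel_of_sym => //; apply: (T_movel yy'T vv').
exact: rel_of_sym.
Qed.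

(** Commutativity of T closes the square: the two steps from x may be taken in either order and end
    at the same point. *)
Lemma T_parallelogram x x' x1 : r x x' \in T -> r x x1 \in T ->
  exists y, r x1 y = r x x' /\ r x' y = r x x1.
Proof.
move=> xx'T xx1T; have [y x1y] := T_ex x1 xx'T; exists y; split=> //.
have := mem_rel_of schemeS x y; rewrite -(T_rel_comp xx1T) ?x1y //.
rewrite T_comm // inE => /existsP[z /= /andP[xz zy]].
have {}xz := rel_of_def schemeS (rel_of_mem schemeS _ _) xz.
by rewrite -(T_fun xx'T xz) (rel_of_def schemeS _ zy) ?rel_of_mem.
Qed.

(* The set L(s) for the relation s containing (x, y), see [left_stabE]. *)
Definition stab x y : {set {set X * X}} :=
  [set t in T | [forall x', (r x x' == t) ==> (r x' y == r x y)]].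

Lemma stab_sub x y : stab x y \subset T.
Proof. by apply/subsetP=> t; rewrite inE => /andP[]. Qed.

Lemma mem_stab x x' y :
  r x x' \in T -> (r x x' \in stab x y) = (r x' y == r x y).
Proof.
move=> xx'T; rewrite inE xx'T; apply/forallP/idP => [/(_ x')|/eqP x'y z].
  by rewrite eqxx.
by apply/implyP => /eqP/(T_fun xx'T)->; apply/eqP.
Qed.

Lemma stabP x y t :
  reflect (exists x', [/\ r x x' = t, t \in T & r x' y = r x y])
          (t \in stab x y).
Proof.
apply: (iffP idP) => [xyt | [x' [<- xx'T /eqP]]]; last by rewrite mem_stab.
have tT := subsetP (stab_sub x y) t xyt; have [x' xx'] := T_ex x tT.
by exists x'; split=> //; apply/eqP; rewrite -mem_stab xx'.
Qed.

(** A witness x' for x is translated along r(x, x1) by the parallelogram to a witness for x1.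
    Together with [stab_mover] and [stab_rel_of] this makes L constant on TsT. *)
Lemma stab_movel x x1 y : r x x1 \in T -> stab x1 y = stab x y.
Proof.
suff sub u u1 : r u u1 \in T -> stab u y \subset stab u1 y.
  by move=> xx1T; apply/eqP; rewrite eqEsubset !sub // T_sym.
move=> uu1T; apply/subsetP=> t /stabP[u' [uu' tT u'y]].
have uu'T : r u u' \in T by rewrite uu'.
have [u1' [u1u1' u'u1']] := T_parallelogram uu'T uu1T.
apply/stabP; exists u1'; rewrite u1u1'; split=> //.
by apply: (T_movel _ _ u'y); rewrite u'u1'.
Qed.

Lemma stab_mover x y y1 : r y y1 \in T -> stab x y1 = stab x y.
Proof.
suff sub u u1 : r u u1 \in T -> stab x u \subset stab x u1.
  by move=> yy1T; apply/eqP; rewrite eqEsubset !sub // T_sym.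
move=> uu1T; apply/subsetP=> t /stabP[x' [xx' tT x'u]].
by apply/stabP; exists x'; split=> //; apply: (T_mover uu1T).
Qed.

Lemma stab_rel_of x y u v : r x y = r u v -> stab x y = stab u v.
Proof.
suff sub x1 y1 u1 v1 : r x1 y1 = r u1 v1 -> stab x1 y1 \subset stab u1 v1.
  by move=> xyuv; apply/eqP; rewrite eqEsubset !sub.
move=> xyuv; apply/subsetP=> t /stabP[x' [xx' tT x'y]].
have [u' uu'] := T_ex u1 tT; apply/stabP; exists u'; split=> //.
by rewrite -xyuv -x'y; apply/esym/(T_movel _ _ xyuv); rewrite xx'.
Qed.

Lemma stab_id x y : rel_id X \in stab x y.
Proof. by apply/stabP; exists x; rewrite rel_of_id ?T_id. Qed.

Lemma stab_subgroup x y : rel_subgroup T (stab x y).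
Proof.
apply/and4P; split; [exact: stab_sub | exact: stab_id | | ].
  apply/forall_inP=> s /stabP[x' [xx' sT x'y]].
  apply/forall_inP=> t; rewrite -{1}(@stab_movel x x') ?xx' //.
  move=> /stabP[x'' [x'x'' tT x''y]]; rewrite -xx' -x'x'' in sT tT *.
  rewrite T_rel_comp //; apply/stabP; exists x''.
  by rewrite (T_trans sT tT) x''y x'y.
apply/forall_inP=> s /stabP[x' [xx' sT x'y]].
rewrite -xx' in sT *; rewrite -(stab_movel y sT).
by apply/stabP; exists x; rewrite -rel_of_inv // T_sym.
Qed.

(* Since [T] is strongly normal, the points z with r y z = r y x all lie in the
   coset of x. *)
Lemma card_stab x y : #|stab x y| = valency (r y x).
Proof.
have out_T z : z \in out y (r y x) -> r x z \in T /\ r y z = r y x.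
  rewrite inE => yz; have {}yz := rel_of_def schemeS (rel_of_mem schemeS _ _) yz.
  split=> //; rewrite T_residue; apply: (thin_residue_rel_of schemeS _ (esym yz)).
  by rewrite -T_residue T_id.
rewrite -(card_out schemeS y) ?rel_of_mem //.
rewrite -(@card_in_imset _ _ (r x)) => [|z z' /out_T[xzT _] _ /esym]; last first.
  by move/(T_fun xzT).
congr #|pred_of_set _|; apply/setP=> t; apply/idP/imsetP.
  move=> /stabP[z [xz tT zy]]; exists z => //; rewrite inE.
  by rewrite -(rel_ofE schemeS) ?rel_of_mem //; apply/eqP/rel_of_sym.
move=> [z /out_T[xzT yz] ->]; rewrite mem_stab //; apply/eqP.
exact: rel_of_sym.
Qed.

Lemma card_stab_sym x y : #|stab x y| = #|stab y x|.
Proof.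
by rewrite !card_stab (rel_of_inv schemeS x) (valency_inv schemeS) ?rel_of_mem.
Qed.

(** If L(s) were trivial, s^* would have valency 1 and so lie in the thin radical, which is T. *)
Lemma stab_neq1 x y : r x y \notin T -> [set rel_id X] \proper stab x y.
Proof.
move=> xyT; rewrite properEcard sub1set stab_id cards1 ltn_neqAle.
have -> : 0 < #|stab x y| by apply/card_gt0P; exists (rel_id X); exact: stab_id.
rewrite andbT; apply: contra xyT => /eqP; rewrite card_stab => yx1.
by apply: T_sym; rewrite T_radical inE rel_of_mem //= -yx1.
Qed.

Lemma stab_transport x y z : stab x y = stab x z -> stab y z \subset stab y x.
Proof.
move=> xyxz; apply/subsetP=> t /stabP[y' [yy' tT y'z]].
have [x' [y'x' x'z]] := rel_of_transport schemeS x (esym y'z).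
have xx'T : r x x' \in T.
  rewrite T_residue; apply: (thin_residue_rel_of schemeS _ (x := z)).
    by rewrite -T_residue T_id.
  exact/esym/rel_of_sym.
have yy'T : r y y' \in T by rewrite yy'.
have : r x x' \in stab x y' by rewrite (stab_mover x yy'T) xyxz mem_stab ?x'z.
rewrite mem_stab // => /eqP x'y'; apply/stabP; exists y'; split=> //.
by rewrite -y'x'; apply: rel_of_sym.
Qed.

(** * Left stabilisers, cosets and quotient relations expressed through points *)

Lemma left_stabE x y : left_stab S T (r x y) = stab x y.
Proof.
have S_xy := rel_of_mem schemeS x y.
apply/setP=> t; rewrite inE; case tT: (t \in T); last first.
  by apply/esym/negP=> /(subsetP (stab_sub x y)); rewrite tT.
have tS := subsetP T_sub t tT.
apply/eqP/stabP => [tr | [x' [xx' _ x'y]]].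
  have := set11 (r x y); rewrite -{1}tr.
  case/(cprodP schemeS); rewrite ?sub1set // => x' [].
  by rewrite !in_set1 => /eqP xx' /eqP x'y; exists x'.
apply/setP=> u; apply/idP/set1P => [ut | ->]; last first.
  apply/(cprodP schemeS); rewrite ?sub1set //; exists x'.
  by rewrite xx' x'y !set11.
have uS : u \in S by apply: subsetP ut; apply: cprod_sub.
have [v [w vw]] := ex_rel_of schemeS uS; rewrite -vw in ut *.
case/(cprodP schemeS): ut; rewrite ?sub1set // => z [].
rewrite !in_set1 => /eqP vz /eqP zw.
(* Since t is thin, the equality r(z, w) = r(x', y) can be moved back along t^* to r(v, w) = r(x,
   y): the product ts contains nothing but s. *)
apply: (@T_movel z v w x' x y); last by rewrite zw x'y.
  by apply: T_sym; rewrite vz.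
by apply: rel_of_sym; rewrite // vz.
Qed.

Lemma mem_outs x y : (y \in outs x T) = (r x y \in T).
Proof.
apply/bigcupP/idP => [[t tT] | xyT]; last by exists (r x y); rewrite ?inE ?mem_rel_of.
by rewrite inE => /(rel_of_def schemeS (subsetP T_sub t tT))->.
Qed.

Lemma outs_eq x y : (outs x T == outs y T) = (r x y \in T).
Proof.
apply/eqP/idP => [xy | xyT]; first by rewrite -mem_outs xy mem_outs rel_of_id ?T_id.
apply/setP=> z; rewrite !mem_outs; apply/idP/idP; apply: T_trans => //.
exact: T_sym.
Qed.

Lemma coset_stabE x y : coset_stab S T (outs x T) (outs y T) = stab x y.
Proof.
have xx : r x x \in T by rewrite rel_of_id ?T_id.
have yy : r y y \in T by rewrite rel_of_id ?T_id.
(* The default [set0] never occurs, as r(x, y) meets the product of the cosets. Any other choice of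
   s contains a pair (u, v) from these cosets, where [stab] has the same value. *)
rewrite /coset_stab; case: pickP => [s /andP[sS] | /(_ (r x y))]; last first.
  rewrite rel_of_mem //= => /eqP/setP/(_ (x, y)).
  by rewrite in_set0 inE mem_rel_of // inE /= !mem_outs xx yy.
case/set0Pn=> -[u v]; rewrite inE => /andP[uvs]; rewrite inE /= !mem_outs.
move=> /andP[xuT yvT]; rewrite -(rel_of_def schemeS sS uvs) left_stabE.
by rewrite (stab_movel v xuT) (stab_mover x yvT).
Qed.

Lemma quotient_rel_mem x y :
  (outs x T, outs y T) \in quotient_rel S T (r x y).
Proof.
have S_xy := rel_of_mem schemeS x y.
apply/imsetP; exists (x, y) => //; rewrite inE /=; apply/bigcupP.
exists (r x y); last by rewrite inE mem_rel_of.
apply/(cprodP schemeS); rewrite ?cprod_sub ?T_sub //.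
exists y; rewrite (rel_of_id schemeS) T_id; split=> //.
apply/(cprodP schemeS); rewrite ?T_sub ?sub1set //.
by exists x; rewrite rel_of_id ?T_id ?set11.
Qed.

(** A pair of cosets in s^T has representatives joined by an element of TsT, where L is constant.
    Hence whatever preserves the quotient relations preserves all L_ij. *)
Lemma quotient_rel_stab x y u v :
  (outs u T, outs v T) \in quotient_rel S T (r x y) -> stab u v = stab x y.
Proof.
have S_xy := rel_of_mem schemeS x y.
case/imsetP=> -[u' v']; rewrite inE /= => /bigcupP[s sTT u'v'] [/eqP uu' /eqP vv'].
rewrite outs_eq in uu'; rewrite outs_eq in vv'.
rewrite -(stab_movel v uu') -(stab_mover u' vv').
rewrite inE in u'v'; have sS : s \in S by apply: subsetP sTT; apply: cprod_sub.
have {}u'v' := rel_of_def schemeS sS u'v'; rewrite -{}u'v' in sTT.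
case/(cprodP schemeS): sTT; rewrite ?cprod_sub ?T_sub // => z [].
move=> /(cprodP schemeS); rewrite ?T_sub ?sub1set //.
case=> // w [u'w]; rewrite in_set1 => /eqP wz zv'.
by rewrite (stab_mover u' zv') -(stab_movel z u'w); apply: stab_rel_of.
Qed.

(** * Lines of the incidence structure and their automorphisms *)

Section Lines.

(** These are the conditions on M in [lines]. That all such M have one common order turns inclusions
    between them into equalities. *)
Definition proper_subgroup M :=
  [&& rel_subgroup T M, [set rel_id X] \proper M & M \proper T].

Variable p : nat.
Hypothesis card_proper_subgroup : forall M, proper_subgroup M -> #|M| = p.

Lemma pointsP C : reflect (exists x, C = outs x T) (C \in points T).
Proof.
by apply: (iffP imsetP) => [[x _]|[x]] ->; exists x; rewrite ?inE.
Qed.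

Lemma outs_point x : outs x T \in points T.
Proof. by apply/pointsP; exists x. Qed.

Lemma mem_line x y M :
  (outs y T \in line S T (outs x T) M) = (r x y \in T) || (stab x y == M).
Proof.
by rewrite !inE eq_sym outs_eq outs_point coset_stabE.
Qed.

Lemma line_sub x M : line S T (outs x T) M \subset points T.
Proof.
apply/subsetP=> D; rewrite !inE => /predU1P[->|/andP[]//]; exact: outs_point.
Qed.

Lemma proper_subgroup_stab_sym x y :
  proper_subgroup (stab x y) -> proper_subgroup (stab y x).
Proof.
case/and3P=> _ s1 sT; rewrite /proper_subgroup stab_subgroup /=.
rewrite !properEcard stab_sub sub1set stab_id /= -card_stab_sym.
by rewrite !(proper_card s1, proper_card sT).
Qed.

Lemma line_exchange x y : proper_subgroup (stab x y) ->
  line S T (outs x T) (stab x y) = line S T (outs y T) (stab y x).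
Proof.
suff sub u v : proper_subgroup (stab u v) ->
    line S T (outs u T) (stab u v) \subset line S T (outs v T) (stab v u).
  move=> xyP; have yxP := proper_subgroup_stab_sym xyP.
  by apply/eqP; rewrite eqEsubset !sub.
move=> uvP; have vuP := proper_subgroup_stab_sym uvP.
apply/subsetP=> D Dl; have /pointsP[z Dz] := subsetP (line_sub _ _) D Dl.
rewrite {D}Dz !mem_line in Dl *; case/orP: Dl => [uzT | /eqP uz].
  by rewrite (stab_mover v uzT) eqxx orbT.
(* When z is outside the coset of v, L(v, z) is nontrivial, and [stab_transport] puts it inside L(v,
   u), so it is a proper subgroup as well. Equal orders then give equality. *)
apply/norP=> -[vzT]; rewrite eqEcard stab_transport //=; apply/negP/negPn.
have vzP : proper_subgroup (stab v z).
  rewrite /proper_subgroup stab_subgroup stab_neq1 //=.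
  have /and3P[_ _] := vuP; exact/sub_proper_trans/stab_transport.
by rewrite !card_proper_subgroup.
Qed.

(** Either x lies in the base coset already, or [line_exchange] moves the base of the line to x. *)
Lemma lines_through x l : l \in lines S T -> outs x T \in l ->
  exists2 M, proper_subgroup M & l = line S T (outs x T) M.
Proof.
case/imsetP=> -[C M]; rewrite inE /= => /and5P[/pointsP[y ->] gM M1 MT _] ->.
have M_P : proper_subgroup M by apply/and3P.
rewrite mem_line => /orP[yxT | /eqP yx].
  by exists M => //; congr line; apply/eqP; rewrite outs_eq.
rewrite -yx in M_P *; exists (stab x y); last exact: line_exchange.
exact: proper_subgroup_stab_sym.
Qed.

Lemma lines_partial_linear_space : partial_linear_space (points T) (lines S T).
Proof.
split=> [l|C D /pointsP[x ->] /pointsP[y ->] xyT|l].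
- case/imsetP=> -[C M]; rewrite inE /= => /and5P[/pointsP[x ->] _ _ _ _] ->.
  exact: line_sub.
(* Once a line is based at x with subgroup M, containing the different point y forces M = L(x,
   y). *)
- rewrite -(cards1 (line S T (outs x T) (stab x y))); apply/subset_leq_card.
  apply/subsetP=> l; rewrite inE => /and3P[lL xl].
  have [M _ ->] := lines_through lL xl; rewrite mem_line -outs_eq (negPf xyT) /=.
  by move=> /eqP->; rewrite set11.
case/imsetP=> -[C M]; rewrite inE /= => /and5P[_ _ _ _ l1] ->.
rewrite ltn_neqAle eq_sym l1.
by apply/card_gt0P; exists C; rewrite !inE eqxx.
Qed.

Lemma card_lines_through C : C \in points T ->
  #|[set l in lines S T | C \in l]| <= #|[set M | proper_subgroup M]|.
Proof.
case/pointsP=> x ->; apply: leq_trans (leq_imset_card (line S T (outs x T)) _).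
apply/subset_leq_card/subsetP=> l; rewrite inE => /andP[lL xl].
have [M M_P ->] := lines_through lL xl.
by rewrite imset_f ?inE.
Qed.

Lemma scheme_aut_line f C M :
  f \in scheme_aut (cosets T) (quotient_rels S T) -> C \in points T ->
  [set f D | D in line S T C M] = line S T (f C) M.
Proof.
rewrite inE => /andP[fT /forall_inP fR].
have fp D : (f D \in points T) = (D \in points T) := perm_closed D fT.
(* f keeps the pair (D, E) inside its own quotient relation, on which the stabiliser is constant. *)
have fstab D E : D \in points T -> E \in points T ->
    coset_stab S T (f D) (f E) = coset_stab S T D E.
  move=> DT ET; have := ET; have := DT; rewrite -fp => /pointsP[u fD].
  rewrite -fp => /pointsP[v fE].
  case/pointsP: DT fD => x -> fx; case/pointsP: ET fE => y -> fy.
  have := fR _ (imset_f _ (rel_of_mem schemeS x y)).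
  move=> /forall_inP/(_ _ (quotient_rel_mem x y)).
  by rewrite fx fy !coset_stabE => /quotient_rel_stab.
move=> CT; apply/setP=> E; apply/imsetP/idP => [[D + ->]|].
  rewrite !inE (inj_eq perm_inj) fp; case: eqP => //= _ /andP[DT].
  by rewrite DT fstab.
move=> E_l; exists (f^-1%g E); last by rewrite permKV.
rewrite -[E](permKV f) !inE (inj_eq perm_inj) fp in E_l *; rewrite permK.
by case: eqP E_l => //= _ /andP[DT]; rewrite DT fstab.
Qed.

Lemma scheme_aut_incidence :
  scheme_aut (cosets T) (quotient_rels S T)
    \subset incidence_aut (points T) (lines S T).
Proof.
apply/subsetP=> f fA; rewrite inE; have := fA; rewrite inE => /andP[fT _].
(* The image family has as many members as [lines S T] because f is injective, so one inclusion
   suffices. *)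
rewrite fT eqEcard [X in _ <= X]card_imset ?leqnn ?andbT; last first.
  exact/imset_inj/perm_inj.
apply/subsetP=> _ /imsetP[_ /imsetP[[C M] + ->] ->]; rewrite inE /=.
move=> /and5P[CT gM M1 MT l1]; rewrite scheme_aut_line //.
apply/imsetP; exists (f C, M) => //=; rewrite inE /= gM M1 MT.
rewrite -scheme_aut_line // card_imset; last exact: perm_inj.
by rewrite l1 perm_closed // CT.
Qed.

End Lines.
End ThinResidue.

(** * Subgroups of C_p x C_p under the relational product *)

Lemma rel_comp_id (X : finType) (s : {set X * X}) : rel_comp (rel_id X) s = s.
Proof.
apply/setP=> -[x y]; rewrite inE /=; apply/existsP/idP => [[z /andP[]]|xy].
  by case/imsetP=> w _ [-> ->].
by exists x; rewrite xy imset_f.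
Qed.

Lemma rel_subgroupI (X : finType) (T M N : {set {set X * X}}) :
  rel_subgroup T M -> rel_subgroup T N -> rel_subgroup T (M :&: N).
Proof.
case/and4P=> MT M1 /forall_inP MM /forall_inP MV.
case/and4P=> NT N1 /forall_inP NN /forall_inP NV; apply/and4P; split.
- exact: subset_trans (subsetIl _ _) MT.
- by rewrite inE M1.
- apply/forall_inP=> s; rewrite inE => /andP[sM sN].
  apply/forall_inP=> t; rewrite inE => /andP[tM tN]; rewrite inE.
  by rewrite (forall_inP (MM s sM)) // (forall_inP (NN s sN)).
by apply/forall_inP=> s; rewrite !inE => /andP[sM sN]; rewrite MV ?NV.
Qed.

Section ElementaryAbelian.
Variables (p : nat) (X : finType) (T : {set {set X * X}}).
Hypothesis p_prime : prime p.
Hypothesis T_CpxCp : isog_CpxCp p T.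
Implicit Types M N : {set {set X * X}}.

Lemma CpxCp_comp : {in T &, forall a b, rel_comp a b \in T}.
Proof.
case: T_CpxCp => f [_ <- fD] _ _ /imsetP[i _ ->] /imsetP[j _ ->].
by rewrite -fD imset_f.
Qed.

Lemma CpxCp_comm : {in T &, forall a b, rel_comp a b = rel_comp b a}.
Proof.
case: T_CpxCp => f [_ <- fD] _ _ /imsetP[i _ ->] /imsetP[j _ ->].
by rewrite -!fD GRing.addrC.
Qed.

Lemma card_CpxCp_index : #|{: 'Z_p * 'Z_p}| = p ^ 2.
Proof. by rewrite card_prod card_ord Zp_cast ?prime_gt1. Qed.

Lemma card_CpxCp : #|T| = p ^ 2.
Proof.
by case: T_CpxCp => f [finj <- _]; rewrite card_imset // cardsT card_CpxCp_index.
Qed.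

(** Lagrange's theorem for the preimage of M under the isomorphism from ['Z_p * 'Z_p]. *)
Lemma dvdn_card_rel_subgroup M : rel_subgroup T M -> #|M| %| p ^ 2.
Proof.
case: T_CpxCp => f [finj fT fD] /and4P[MT M1 /forall_inP MM _].
(* Write the identity relation as f e; being a left unit, it gives f 0 = f (e + 0) = f e. *)
have f0 : f 0%R = rel_id X.
  have /imsetP[e _ fe] : rel_id X \in f @: setT by rewrite fT (subsetP MT).
  by rewrite -[LHS]rel_comp_id fe -fD GRing.addr0.
have gM : group_set (f @^-1: M).
  apply/group_setP; split=> [|i j]; first by rewrite inE f0.
  by rewrite !inE => iM jM; rewrite fD (forall_inP (MM _ iM)).
have -> : M = f @: (f @^-1: M).
  apply/setP=> s; apply/idP/imsetP => [sM | [i + ->]]; last by rewrite inE.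
  have /imsetP[i _ si] : s \in f @: setT by rewrite fT (subsetP MT).
  by exists i; rewrite // inE -si.
rewrite card_imset // -card_CpxCp_index -cardsT.
exact: (cardSg (subsetT (Group gM))).
Qed.

(** The order is 1, p or p^2, and the two strict inclusions exclude the extremes. *)
Lemma card_proper_rel_subgroup M : proper_subgroup T M -> #|M| = p.
Proof.
case/and3P=> gM M1 MT; have := dvdn_card_rel_subgroup gM.
case/(dvdn_pfactor _ _ p_prime) => -[|[|[|//]]] _ cM; last 2 first.
- by rewrite cM expn1.
- by have := proper_card MT; rewrite card_CpxCp cM ltnn.
by have := proper_card M1; rewrite cM cards1.
Qed.

(** The common element t makes the intersection of M and N nontrivial, so it too has order p and
    fills both. *)
Lemma proper_subgroup_eq M N t : proper_subgroup T M -> proper_subgroup T N ->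
  t != rel_id X -> t \in M -> t \in N -> M = N.
Proof.
move=> M_P N_P t1 tM tN; have MN_P : proper_subgroup T (M :&: N).
  have [/and3P[gM _ MT] /and3P[gN _ _]] := (M_P, N_P).
  apply/and3P; split; first exact: rel_subgroupI.
    apply/properP; split; last by exists t; rewrite !inE ?tM.
    by rewrite sub1set; case/and4P: (rel_subgroupI gM gN).
  exact: sub_proper_trans (subsetIl _ _) MT.
have MN_M : M :&: N = M.
  by apply/eqP; rewrite eqEcard subsetIl !card_proper_rel_subgroup ?leqnn.
rewrite -MN_M; apply/eqP.
by rewrite eqEcard subsetIr !card_proper_rel_subgroup ?leqnn.
Qed.

(* The sets of nontrivial elements of these subgroups, of size p - 1 each, are
   pairwise disjoint in the p ^ 2 - 1 nontrivial elements of T. *)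
Lemma card_proper_subgroups : #|[set M | proper_subgroup T M]| <= p.+1.
Proof.
have p1 : 0 < p.-1 by rewrite -ltnS prednK ?prime_gt1 ?prime_gt0.
have [idT|idT] := boolP (rel_id X \in T); last first.
  rewrite eq_card0 // => M; rewrite !inE; apply: contraNF idT.
  by case/and3P=> /and4P[/subsetP MT M1 _ _] _ _; apply: MT.
rewrite -(leq_pmul2r p1) -sum_nat_const.
have -> : p.+1 * p.-1 = #|T :\ rel_id X|.
  rewrite -[RHS]/(true + _).-1 -idT -cardsD1 card_CpxCp.
  by rewrite -(subn1 (p ^ 2)) -[X in _ - X](exp1n 2) subn_sqr subn1 addn1 mulnC.
rewrite (eq_bigr (fun M => \sum_(t in T :\ rel_id X | t \in M) 1)) => [|M].
  rewrite (exchange_big_dep (mem (T :\ rel_id X))) => [|M t _ /andP[]//] /=.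
  rewrite -[leqRHS]sum1_card; apply: leq_sum => t.
  rewrite in_setD1 => /andP[t1 tT].
  rewrite (eq_bigl (mem [set M | proper_subgroup T M & t \in M])) => [|M].
    rewrite sum1_card; apply/card_le1_eqP => M N.
    rewrite !inE => /andP[M_P tM] /andP[N_P tN].
    exact: (proper_subgroup_eq N_P M_P t1).
  by rewrite !inE t1 tT.
rewrite inE => M_P; have /and3P[/and4P[/subsetP MT M1 _ _] _ _] := M_P.
rewrite -(card_proper_rel_subgroup M_P) (cardsD1 (rel_id X)) M1 -sum1_card /=.
apply: eq_bigl => t; rewrite !inE -andbA.
by case tM: (t \in M); rewrite ?andbF // MT.
Qed.

End ElementaryAbelian.

Theorem theorem2p7 (p : nat) (X : finType) (S T : {set {set X * X}})
    (p_prime : prime p) (schemeS : association_scheme S)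
    (T_radical : T = thin_radical S) (T_residue : T = thin_residue S)
    (T_CpxCp : isog_CpxCp p T) :
  [/\ partial_linear_space (points T) (lines S T),
      {in points T, forall C : {set X},
        #|[set l : {set {set X}} in lines S T | C \in l]| <= p.+1}
    & scheme_aut_group (cosets T) (quotient_rels S T)
        \subset incidence_aut_group (points T) (lines S T)].
Proof.
have Tcomp := CpxCp_comp T_CpxCp; have Tcomm := CpxCp_comm T_CpxCp.
have cardP := card_proper_rel_subgroup p_prime T_CpxCp.
split; first exact: lines_partial_linear_space cardP.
  move=> C CT; apply: leq_trans (card_proper_subgroups p_prime T_CpxCp).
  exact: card_lines_through cardP _ CT.
exact: scheme_aut_incidence.
Qed.
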